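(* For every integer $r\ge 2$ there is $n_0(r)$ such that the following holds. Let $n\ge n_0(r)$ be even and $0 \leq d \leq \frac{n}{28r^2}$, and let $G$ be a graph with $n$ vertices and minimum degree at least $\frac{(r+1)n}{2r} + d$. Then in every $r$-colouring of the edges of $G$ there is a perfect matching with at least $\frac{n}{2r} + d$ edges of the same colour.
   Context: Graphs are finite and simple. An $r$-colouring of the edges is an arbitrary map $E(G)\to[r]$. *)

(* Defs.v *)
From mathcomp Require Import all_boot all_order all_algebra.
From mathcomp Require Import reals.

Set Implicit Arguments.
Unset Strict Implicit.
Unset Printing Implicit Defensive.

Record sgraph (V : finType) := SGraph {
  adj :> rel V;
  adj_sym : symmetric adj;
  adj_irr : irreflexive adj }.

Section Graph.
Variables (V : finType) (G : sgraph V).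

Definition degree (v : V) : nat := #|[set w | G v w]|.

(* Every degree is below #|V|, so the default value #|V| of the iterated
   minimum plays no role as soon as V is nonempty. *)
Definition min_degree : nat := \big[minn/#|V|]_(v : V) degree v.

Lemma leq_min_degree (k : nat) : 0 < #|V| ->
  (k <= min_degree) = [forall v, k <= degree v].
Proof.
move=> /card_gt0P[v0 _]; apply/idP/forallP => [kd v|kd].
  apply: (leq_trans kd); rewrite /min_degree.
  have : v \in index_enum V by rewrite mem_index_enum.
  elim: (index_enum V) => // u s IHs; rewrite big_cons inE.
  by case/predU1P => [->|/IHs]; [apply: geq_minl | apply/leq_trans/geq_minr].
apply: (big_ind (fun m => k <= m)) => // [|m p km kp].
  exact: leq_trans (kd v0) (max_card _).
by rewrite leq_min km.
Qed.

Definition edges : {set {set V}} := [set [set p.1; p.2] | p : V * V & G p.1 p.2].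

Definition edge : finType := {f : {set V} | f \in edges}.

Definition perfect_matching (M : {set edge}) : Prop :=
  forall v : V, #|[set f in M | v \in val f]| = 1.

End Graph.

(* Main.v *)
Require Import Defs.
From mathcomp Require Import all_boot all_order all_algebra.
From mathcomp Require Import reals zify ring.

(* Let m be the ceiling of n/(2r) + d, so that the minimum degree is at least
   n/2 + m.  A monochromatic matching with exactly m edges extends to a perfect
   matching: deleting its 2m vertices leaves a graph satisfying Dirac's degree
   condition.  If every colour i had matching number below m, then an
   augmenting-path argument would give sets S_i with |S_i| < m outside of which
   colour i spans at most 2 (m - 1 - |S_i|) m edges.  The average degree of
   the vertices outside all S_i would then be smaller than the minimum degree. *)

Set Implicit Arguments.
Unset Strict Implicit.
Unset Printing Implicit Defensive.

Lemma leq_card_bigcup (T I : finType) (P : pred I) (A : I -> {set T}) :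
  #|\bigcup_(i | P i) A i| <= \sum_(i | P i) #|A i|.
Proof.
elim/big_ind2: _ => [|B b C c hb hc|//]; first by rewrite cards0.
exact: leq_trans (leq_card_setU _ _) (leq_add hb hc).
Qed.

(** * Matchings, augmenting paths and their structural consequences *)

Section Matching.
Variables (V : finType) (e : rel V).
Implicit Types (f g : {ffun V -> V}) (u v x y : V).

(** A matching is encoded as the involution that swaps the ends of its edges and fixes the unmatched
    vertices, so [#|matched f|] is twice its number of edges. *)
Definition matching f : bool :=
  [forall x, (f (f x) == x) && ((f x != x) ==> e x (f x))].

Definition matched f : {set V} := [set x | f x != x].

Lemma matchingP f :
  reflect (involutive f /\ forall x, f x != x -> e x (f x)) (matching f).
Proof.
apply: (iffP forallP) => [h|[fK fe] x]; last first.
  by rewrite fK eqxx; apply/implyP/fe.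
by split=> x; have /andP[/eqP ? /implyP] := h x.
Qed.

Lemma matchedF f x : (x \in matched f) = (f x != x).
Proof. by rewrite inE. Qed.

(** [f] exchanges the vertices ranked below their partner, collected in [A], with those ranked above
    it. *)
Lemma card_matched_even f : involutive f -> ~~ odd #|matched f|.
Proof.
move=> fK; pose A := [set x | enum_rank x < enum_rank (f x)].
have fA : f @: A = [set x | enum_rank (f x) < enum_rank x].
  apply/setP => x; apply/imsetP/idP => [[y]|]; rewrite !inE.
    by move=> ? ->; rewrite fK.
  by exists (f x); rewrite ?inE fK.
have <- : A :|: f @: A = matched f.
  apply/setP => x; rewrite fA !inE -neq_ltn (inj_eq val_inj) eq_sym.
  by rewrite (inj_eq enum_rank_inj).
rewrite cardsU (card_imset _ (can_inj fK)) fA.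
rewrite (_ : _ :&: _ = set0) ?cards0 ?subn0 ?addnn ?odd_double //.
by apply/setP => x; rewrite !inE; case: ltngtP.
Qed.

Hypothesis e_sym : symmetric e.

(* Meant for [u] unmatched: [x] leaves its partner, if any, for [u]. *)
Definition rematch f u x : {ffun V -> V} :=
  [ffun y => if y == u then x else if y == x then u
             else if y == f x then y else f y].

Lemma rematch_matching f u x :
  matching f -> f u = u -> e u x -> matching (rematch f u x).
Proof.
move=> /matchingP[fK fe] fu ux; apply/matchingP; split=> y; rewrite !ffunE.
  have [->|yu] := eqVneq y u; first by rewrite eqxx; case: (x =P u).
  have [->|yx] := eqVneq y x; first by rewrite eqxx.
  have [yfx|yfx] := eqVneq y (f x).
    by rewrite (negPf yu) (negPf yx) yfx eqxx.
  rewrite !(can2_eq fK fK) fu fK.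
  by rewrite (negPf yu) (negPf yfx) (negPf yx).
have [->|yu] := eqVneq y u; first by [].
have [->|yx] := eqVneq y x; first by rewrite e_sym.
by case: ifP => [_|_]; [rewrite eqxx | apply: fe].
Qed.

Lemma card_rematch_matched f u x :
  involutive f -> f u = u -> f x != x ->
  #|matched (rematch f u x)| = #|matched f|.
Proof.
move=> fK fu fx.
have ux : u != x by apply: contraNneq fx => <-; rewrite fu.
have ufx : u != f x by apply: contraNneq ux => /(congr1 f); rewrite fK fu => ->.
have -> : matched (rematch f u x) = u |: (matched f :\ f x).
  apply/setP => y; rewrite !inE ffunE.
  have [->|yu] /= := eqVneq y u; first by rewrite eq_sym.
  have [->|yx] := eqVneq y x; first by rewrite ux fx eq_sym fx.
  by case: (y =P f x); rewrite ?eqxx.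
rewrite cardsU1 !inE fu eqxx andbF [RHS](cardsD1 (f x)).
by rewrite matchedF fK eq_sym fx.
Qed.

Lemma card_rematch_unmatched f u x :
  u != x -> f u = u -> f x = x ->
  #|matched (rematch f u x)| = #|matched f|.+2.
Proof.
move=> ux fu fx.
have -> : matched (rematch f u x) = u |: (x |: matched f).
  apply/setP => y; rewrite !inE ffunE.
  have [->|yu] /= := eqVneq y u; first by rewrite eq_sym.
  by have [->|yx] := eqVneq y x; rewrite ?ux // fx (negPf yx).
by rewrite !cardsU1 !inE fu fx !eqxx (negPf ux).
Qed.

Definition maximum_matching f : Prop :=
  matching f /\ forall g, matching g -> #|matched g| <= #|matched f|.

Lemma maximum_matching_exists : exists f, maximum_matching f.
Proof.
have m0 : matching [ffun x => x].
  by apply/matchingP; split=> x; rewrite !ffunE // eqxx.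
case: (@arg_maxnP _ [ffun x => x] matching (fun f => #|matched f|) m0).
by move=> f mf fmax; exists f; split.
Qed.

Lemma maximum_rematch f u x : maximum_matching f ->
  f u = u -> f x != x -> e u x -> maximum_matching (rematch f u x).
Proof.
move=> [mf fmax] fu fx ux; split; first exact: rematch_matching.
by have [fK _] := matchingP _ mf; move=> g /fmax; rewrite card_rematch_matched.
Qed.

Lemma maximum_unmatched f u v : maximum_matching f ->
  u != v -> f u = u -> f v = v -> ~~ e u v.
Proof.
move=> [mf fmax] uv fu fv; apply/negP => euv.
have := fmax _ (rematch_matching mf fu euv).
by rewrite card_rematch_unmatched // => /ltnW; rewrite ltnn.
Qed.

(** Otherwise [u], [x], [f x], [v] would be an augmenting path: rematching [x] to [u] keeps the
    matching maximum and leaves the adjacent vertices [f x] and [v] both unmatched. *)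
Lemma maximum_no_augmenting f u v x : maximum_matching f ->
  u != v -> f u = u -> f v = v -> f x != x -> e u x -> ~~ e (f x) v.
Proof.
move=> fmax uv fu fv fx ux; have [fK _] := matchingP _ fmax.1.
have vx : v != x by apply: contraNneq fx => <-; rewrite fv.
have nfxu : f x != u.
  by apply: contraNneq fx => E; rewrite E -fu -E fK.
have vfx : f x != v.
  by apply: contraNneq fx => E; rewrite E -fv -E fK.
apply: (maximum_unmatched (maximum_rematch fmax fu fx ux)) => //.
  by rewrite ffunE (negPf nfxu) (negPf fx) eqxx.
by rewrite ffunE eq_sym (negPf uv) (negPf vx) eq_sym (negPf vfx).
Qed.

Lemma card_matched_below f m :
  matching f -> #|matched f| < m.*2 -> #|matched f| <= m.-1.*2.
Proof. by case/matchingP => /card_matched_even; lia. Qed.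

(** A smallest matching with at least [m] edges has exactly [m], since otherwise an edge could be
    dropped, as in [g'] below. *)
Lemma matching_exact_card f m : matching f -> m.*2 <= #|matched f| ->
  exists2 g, matching g & #|matched g| = m.*2.
Proof.
move=> mf hf.
pose P (g : {ffun V -> V}) := matching g && (m.*2 <= #|matched g|).
have Pf : P f by rewrite /P mf.
case: (@arg_minnP _ f P (fun f => #|matched f|) Pf).
move=> g /andP[mg hg] gmin; exists g => //.
apply/eqP; rewrite eq_sym eqn_leq hg leqNgt; apply/negP => mltg.
have [gK ge] := matchingP _ mg.
have := card_matched_even gK => gev.
have [x gx] : exists x, x \in matched g by apply/card_gt0P; lia.
rewrite matchedF in gx.
pose g' : {ffun V -> V} := [ffun y => if (y == x) || (y == g x) then y else g y].
have mg' : matching g'.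
  apply/matchingP; split=> y; rewrite !ffunE.
    case: (boolP ((y == x) || _)) => [-> //|/norP[yx ygx]].
    by rewrite !(can2_eq gK gK) !gK (negPf yx) (negPf ygx).
  by case: ifP => [_|_]; [rewrite eqxx | apply: ge].
have E : matched g' = matched g :\ x :\ g x.
  apply/setP => y; rewrite !inE ffunE.
  by have [|] := eqVneq y x; have [|] := eqVneq y (g x); rewrite ?eqxx.
have C : #|matched g| = #|matched g'|.+2.
  rewrite (cardsD1 x) (cardsD1 (g x)) -E !inE gK gx.
  by rewrite eq_sym gx.
suff /gmin : P g' by lia.
by rewrite /P mg'; lia.
Qed.

(* [S] collects the vertices with two unmatched neighbours in a maximum
   matching [f].  Their partners [T] and the unmatched vertices [U] form an
   independent set, since any edge there would give an augmenting path; every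
   other vertex [W] has at most one neighbour in [U]. *)
Lemma sparse_complement mu : irreflexive e ->
  (forall g, matching g -> #|matched g| <= mu) ->
  exists S : {set V}, #|S|.*2 <= mu /\
    \sum_(x in ~: S) #|[set y in ~: S | e x y]| <= (mu - #|S|.*2) * mu.+2.
Proof.
move=> e_irr hmu; have [f fmax] := maximum_matching_exists.
have [mf _] := fmax; have [fK fe] := matchingP _ mf.
pose U := ~: matched f; have inU u : (u \in U) = (f u == u) by rewrite !inE negbK.
pose NU x := [set u in U | e x u].
pose S := [set x in matched f | 1 < #|NU x|].
pose T := [set x | f x \in S].
pose W := matched f :\: (S :|: T).
(* Of two unmatched neighbours, at least one avoids any prescribed [v]. *)
have SP s v : s \in S -> f s != s /\ exists u, [/\ u != v, f u = u & e s u].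
  rewrite inE matchedF => /andP[fs /card_gt1P[u1 [u2]]].
  rewrite !inE !negbK.
  move=> [/andP[/eqP f1 e1] /andP[/eqP f2 e2] u12]; split=> //.
  have [u1v|] := eqVneq u1 v; last by exists u1.
  by exists u2; split=> //; rewrite -u1v eq_sym.
have TU t v : t \in T -> f v = v -> ~~ e t v.
  rewrite inE => /(SP _ v)[fs [u [uv fu su]]] fv.
  by have := maximum_no_augmenting fmax uv fu fv fs; rewrite fK e_sym; apply.
have TS t : t \in T -> t \notin S.
  move=> tT; apply/negP => /(SP _ t)[_ [u [_ fu tu]]].
  by have := TU _ _ tT fu; rewrite tu.
(* An edge [t t'] would give the augmenting path [u], [f t], [t], [t'], [f t'], [u'] with [u]
   distinct from [u']. Rematching [f t] to [u] frees [t] and reduces this to the shorter path [t],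
   [t'], [f t'], [u']. *)
have TT t t' : t \in T -> t' \in T -> ~~ e t t'.
  move=> tT t'T; apply/negP => tt'.
  have sS : f t \in S by move: tT; rewrite inE.
  have t't : t' != t by apply: contraTneq tt' => ->; rewrite e_irr.
  have t's : t' != f t by apply: contraTneq sS => <-; apply: TS.
  move: (t'T); rewrite inE => /(SP _ t)[ft' [u' [_ fu' s'u']]].
  have [fs [u [uu' fu su]]] := SP _ u' sS.
  rewrite !fK in ft' fs.
  have us : e u (f t) by rewrite e_sym.
  have gmax : maximum_matching (rematch f u (f t)).
    by apply: maximum_rematch => //; rewrite fK.
  have unm v x : f v = v -> f x != x -> x != v.
    by move=> fv; apply: contraNneq => ->; rewrite fv.
  have ft : f t != t by rewrite eq_sym.
  have ft'' : f t' != t' by rewrite eq_sym.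
  have tu' := unm _ _ fu' ft.
  have := @maximum_no_augmenting _ t u' t' gmax tu'.
  rewrite !ffunE fK eqxx (negPf (unm _ _ fu ft)) (negPf fs) => /(_ erefl).
  rewrite eq_sym (negPf uu') eq_sym (negPf (unm _ _ fu' _)) ?fK //.
  rewrite eq_sym (negPf tu') => /(_ fu').
  rewrite (negPf (unm _ _ fu ft'')) (negPf t's) (negPf t't).
  by move=> /(_ ft'' tt'); rewrite s'u'.
pose I := T :|: U.
have II x y : x \in I -> y \in I -> ~~ e x y.
  rewrite 2!in_setU !inU => /orP[xT|/eqP xU] /orP[yT|/eqP yU].
  - exact: TT.
  - exact: TU.
  - by rewrite e_sym TU.
  - have [->|xy] := eqVneq x y; first by rewrite e_irr.
    exact: (maximum_unmatched fmax).
have fS x : x \in S -> f x != x by case/(SP _ x).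
have fT x : x \in T -> f x != x by rewrite inE => /fS; rewrite fK eq_sym.
have cardT : #|T| = #|S|.
  rewrite -(card_imset S (can_inj fK)); apply: eq_card => x.
  rewrite inE; apply/idP/imsetP => [fxS|[y yS ->]]; last by rewrite fK.
  by exists (f x); rewrite ?fK.
have cardM : #|matched f| = #|S|.*2 + #|W|.
  have sub : S :|: T \subset matched f.
    by apply/subsetP => x /setUP[/fS|/fT]; rewrite matchedF.
  rewrite -(cardsID (S :|: T)) (setIidPr sub) cardsU cardT.
  rewrite (_ : S :&: T = set0) ?cards0 ?subn0 ?addnn //.
  by apply/setP => x; rewrite in_setI in_set0; apply/andP => -[xS /TS]; rewrite xS.
have WS x : x \in W -> x \notin S by rewrite in_setD in_setU => /andP[/norP[]].
have inI x : x \notin S -> x \notin W -> x \in I.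
  move=> xS; rewrite in_setD in_setU (negPf xS) /= !in_setU in_setC.
  by case: (x \in T).
have NUle x : x \in W -> #|NU x| <= 1.
  move=> xW; have := WS _ xW; move: xW; rewrite in_setD => /andP[_ xM].
  by rewrite inE xM -leqNgt.
have degI x : x \in W -> #|[set y in I | e x y]| <= #|T|.+1.
  move=> xW; rewrite -addn1; apply: leq_trans (leq_add (leqnn _) (NUle _ xW)).
  apply: leq_trans (leq_card_setU _ _); apply: subset_leq_card.
  apply/subsetP => y; rewrite !in_setU !in_set.
  by case/andP => /orP[-> //|-> ->]; rewrite orbT.
have degW x : x \in W -> #|[set y in ~: S | e x y]| <= #|W| + #|T|.+1.
  move=> xW; apply: leq_trans (leq_add (leqnn _) (degI _ xW)).
  apply: leq_trans (leq_card_setU _ _); apply: subset_leq_card.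
  apply/subsetP => y; rewrite in_setU [in X in X -> _]in_set.
  rewrite [y \in [set _ in I | _]]in_set in_setC.
  by case/andP => yS ->; rewrite andbT; case: (boolP (y \in W)) => // /(inI _ yS).
have swap : \sum_(x in I) #|[set y in W | e x y]| =
            \sum_(y in W) #|[set x in I | e y x]|.
  under eq_bigr do rewrite -sum1dep_card.
  under [RHS]eq_bigr do rewrite -sum1dep_card.
  rewrite (exchange_big_dep (fun y => y \in W)) /=; last by move=> ? ? _ /andP[].
  apply: eq_bigr => y yW; apply: eq_bigl => x.
  by rewrite yW e_sym.
have cf : #|matched f| <= mu := hmu _ mf.
exists S; split; first by lia.
(* The first product bounds the degrees of the vertices of [W]. The remaining vertices lie in the
   independent set [I], so outside [S] their edges all go to [W]; the second product counts these
   from the side of [W]. *)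
have : \sum_(x in ~: S) #|[set y in ~: S | e x y]| <=
       #|W| * (#|W| + #|T|.+1) + #|W| * #|T|.+1.
  rewrite (bigID (fun x => x \in W)) /= leq_add //.
    rewrite -sum_nat_const (eq_bigl (fun x => x \in W)); first exact: leq_sum.
    by move=> x; rewrite in_setC andb_idl // => /WS.
  rewrite -sum_nat_const.
  apply: (@leq_trans (\sum_(y in W) #|[set x in I | e y x]|)); last exact: leq_sum.
  rewrite -swap [leqRHS](bigID (fun x => x \notin S)) /=.
  apply: leq_trans (leq_addr _ _).
  rewrite [leqRHS](bigID (fun x => x \notin W)) /=.
  apply: leq_trans (leq_addr _ _).
  rewrite [leqRHS](eq_bigl (fun x => (x \in ~: S) && (x \notin W))); last first.
    move=> x; rewrite in_setC; case: (boolP (x \in S)); rewrite ?andbF // => xS.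
    by case: (boolP (x \in W)); rewrite ?andbF // => xW; rewrite inI.
  apply: leq_sum => x /andP[]; rewrite in_setC => xS xW.
  apply: subset_leq_card; apply/subsetP => y.
  rewrite 2![y \in [set _ | _]]in_set in_setC => /andP[yS xy].
  have := II x y (inI _ xS xW); rewrite xy => yI.
  by case: (boolP (y \in W)) => // /(inI _ yS) /yI.
(* By [cardM] and [cf], [#|W|] is at most [mu - #|S|.*2], and [#|W| + 2 * (#|T| + 1)] is at most
   [mu + 2]. *)
move/leq_trans; apply; rewrite -mulnDr; apply: leq_mul; lia.
Qed.

(* Dirac's argument: two vertices of [B] left unmatched by a maximum matching
   would have neighbours joined by one of its edges, by pigeonhole. *)
Lemma dirac_matching (B : {set V}) : irreflexive e ->
  (forall u v, e u v -> u \in B) ->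
  (forall u, u \in B -> #|B| <= #|[set v | e u v]|.*2) ->
  exists2 f, matching f &
    forall u v, u \in B -> v \in B -> f u = u -> f v = v -> u = v.
Proof.
move=> e_irr eB hdeg; have [f fmax] := maximum_matching_exists.
have [mf _] := fmax; have [fK fe] := matchingP _ mf.
exists f => // u v uB vB fu fv; apply/eqP/contraT => uv.
pose Q := matched f; pose N x := [set y | e x y].
have QB : Q \subset B by apply/subsetP => x; rewrite matchedF => /fe /eB.
have NQ w : f w = w -> N w \subset Q.
  move=> fw; apply/subsetP => y; rewrite inE matchedF => wy.
  apply: contraTneq (wy) => fy; apply: (maximum_unmatched fmax) => //.
  by apply: contraTneq wy => ->; rewrite e_irr.
have fNQ : f @: N v \subset Q.
  apply/subsetP => _ /imsetP[y yN ->]; rewrite matchedF fK eq_sym -matchedF.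
  exact: (subsetP (NQ v fv)).
have ltQB : #|Q| < #|B|.
  apply: proper_card; rewrite properE QB /=; apply/subsetPn.
  by exists u; rewrite // matchedF fu eqxx.
have leU : #|N u :|: f @: N v| <= #|Q|.
  by apply: subset_leq_card; rewrite subUset NQ.
have := cardsUI (N u) (f @: N v); rewrite (card_imset _ (can_inj fK)).
have := hdeg _ uB; have := hdeg _ vB; rewrite -!/(N _) => dv du dUI.
(* Both sets lie in [Q], which is smaller than [B], while their sizes add up to at least [#|B|]. *)
have /card_gt0P[w] : 0 < #|N u :&: f @: N v| by lia.
rewrite in_setI => /andP[]; rewrite inE => uw /imsetP[y]; rewrite inE => vy wy.
have fw : f w != w by rewrite -matchedF (subsetP (NQ u fu)) // inE.
by have := maximum_no_augmenting fmax uv fu fv fw uw; rewrite wy fK e_sym vy.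
Qed.

End Matching.

(** * Extending a matching to a perfect one *)

Lemma matching_extends_to_perfect (V : finType) (e : rel V) (f : {ffun V -> V}) :
  symmetric e -> irreflexive e -> ~~ odd #|V| -> matching e f ->
  (forall x, #|V| + #|matched f| <= #|[set y | e x y]|.*2) ->
  exists2 h, matching e h &
    (forall x, h x != x) /\ {in matched f, h =1 f}.
Proof.
move=> e_sym e_irr Veven mf hdeg; have [fK fe] := matchingP _ _ mf.
(* Deleting [K] is modelled on the same vertex type by isolating its vertices. Each other vertex
   loses at most [#|K|] neighbours, which leaves twice its degree at least [#|V| - #|K|]. *)
pose K := matched f; pose e' x y := [&& e x y, x \notin K & y \notin K].
have e'_sym : symmetric e' by move=> x y; rewrite /e' e_sym [X in _ && X]andbC.
have e'_irr : irreflexive e' by move=> x; rewrite /e' e_irr.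
have [u v||g mg gB] := @dirac_matching _ e' e'_sym (~: K) e'_irr.
- by rewrite in_setC => /and3P[].
- move=> u; rewrite in_setC => uK; have := cardsC K; have := hdeg u.
  suff : #|[set y | e u y]| <= #|[set y | e' u y]| + #|K| by rewrite -/K; lia.
  apply: leq_trans (leq_card_setU _ _); apply: subset_leq_card.
  apply/subsetP => y; rewrite in_setU !in_set /e' uK => ->.
  by rewrite /= -matchedF orNb.
have [gK ge] := matchingP _ _ mg.
have gfix x : x \in K -> g x = x.
  by move=> xK; apply/eqP/contraT => /ge; rewrite /e' xK andbF.
have fKK x : (f x \in K) = (x \in K) by rewrite !matchedF fK eq_sym.
have gKK x : (g x \in K) = (x \in K).
  have [->//|gx] := eqVneq (g x) x.
  by have /and3P[_ /negPf -> /negPf ->] := ge _ gx.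
pose h := [ffun x => if x \in K then f x else g x].
have mh : matching e h.
  apply/matchingP; split=> x; rewrite !ffunE.
    case: (boolP (x \in K)) => xK; first by rewrite fKK xK fK.
    by rewrite gKK (negPf xK) gK.
  by case: ifP => _; [apply: fe | move/ge => /and3P[]].
exists h => //; split=> [x|x xK]; last by rewrite ffunE xK.
(* A fixed point of [h] would be its only one by [gB], and an even number of matched vertices would
   then make [#|V|] odd. *)
apply: contraNneq Veven => hx.
suff : matched h = ~: [set x].
  have [hK _] := matchingP _ _ mh; have := card_matched_even hK.
  by move=> + E; have := cardsC1 x; have := cardsC [set x]; rewrite E cards1; lia.
have unm y : h y = y -> (y \in ~: K) /\ g y = y.
  rewrite in_setC ffunE; case: ifP => // yK fy.
  by move: yK; rewrite matchedF fy eqxx.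
apply/setP => y; rewrite in_setC1 matchedF; congr (~~ _).
apply/eqP/eqP => [hy|->//].
by have [yB gy] := unm _ hy; have [xB gx] := unm _ hx; apply: gB.
Qed.

(** * A large matching in some colour *)

Lemma monochromatic_matching (V : finType) (r : nat) (E : 'I_r -> rel V)
    (delta m : nat) :
  (forall i, symmetric (E i)) -> (forall i, irreflexive (E i)) ->
  (forall x, delta <= \sum_i #|[set y | E i x y]|) -> 0 < m ->
  (forall s, s <= r * m.-1 ->
    4 * m * (r * m.-1 - s) < (#|V| - s) * (delta - s)) ->
  exists (i : 'I_r) (f : {ffun V -> V}),
    matching (E i) f /\ m.*2 <= #|matched f|.
Proof.
move=> Esym Eirr hdeg m0 harith.
case: (boolP [exists i, [exists f : {ffun V -> V},
        matching (E i) f && (m.*2 <= #|matched f|)]]).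
  by case/existsP => i /existsP[f /andP[]]; exists i, f.
move=> /existsPn none.
have small i (g : {ffun V -> V}) : matching (E i) g -> #|matched g| <= m.-1.*2.
  move=> mg; apply: (card_matched_below mg); rewrite ltnNge.
  by apply: contra (none i) => le; apply/existsP; exists g; rewrite mg.
have /fin_all_exists[S hS] i := sparse_complement (Esym i) (Eirr i) (small i).
pose X := ~: \bigcup_i S i; pose s := \sum_i #|S i|.
pose D i := \sum_(x in ~: S i) #|[set y in ~: S i | E i x y]|.
have Sle i : #|S i| <= m.-1 by rewrite -leq_double; have [] := hS i.
(* This is the bound of [sparse_complement] for [mu = 2 * (m - 1)], where [mu + 2 = 2 * m]. *)
have Dle i : D i <= 4 * m * (m.-1 - #|S i|).
  by have [_ /leq_trans] := hS i; apply; nia.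
have ssum : s + \sum_i (m.-1 - #|S i|) = r * m.-1.
  rewrite -big_split /= (eq_bigr (fun=> m.-1)) => [|i _]; last by rewrite subnKC.
  by rewrite sum_nat_const card_ord.
have Xge : #|V| - s <= #|X|.
  by rewrite -(cardsC (\bigcup_i S i)) leq_subLR leq_add2r leq_card_bigcup.
(* At a vertex of [X], at most [#|S i|] edges of colour [i] end in [S i]; the others are counted in
   [D i], as [X] avoids [S i]. *)
have count : #|X| * delta <= #|X| * s + \sum_i D i.
  rewrite -!sum_nat_const /s.
  apply: (@leq_trans (\sum_(x in X) \sum_i #|[set y | E i x y]|)).
    exact: leq_sum.
  apply: (@leq_trans (\sum_(x in X) (\sum_i #|S i| +
            \sum_i #|[set y in ~: S i | E i x y]|))).
    apply: leq_sum => x xX; rewrite -big_split; apply: leq_sum => i _.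
    apply: leq_trans (leq_card_setU _ _); apply: subset_leq_card.
    by apply/subsetP => y; rewrite in_setU !in_set => ->; rewrite andbT orbN.
  rewrite big_split leq_add2l exchange_big; apply: leq_sum => i _.
  rewrite /D [leqRHS](bigID (fun x => x \in X)) /=.
  apply: leq_trans (leq_addr _ _); apply: eq_leq; apply: eq_bigl => x.
  rewrite andb_idl // => xX; rewrite in_setC; apply: contraL xX => xS.
  by rewrite in_setC negbK; apply/bigcupP; exists i.
have : \sum_i D i <= 4 * m * \sum_i (m.-1 - #|S i|).
  by rewrite big_distrr; apply: leq_sum.
have := harith s; move: ssum Xge count; move: (\sum_i D i) (\sum_i (_ - _)) #|X| => a b c.
move=> ssum Xge count; rewrite -ssum leq_addr addKn => /(_ isT) lt le.
have : c * (delta - s) <= 4 * m * b by rewrite mulnBr leq_subLR; lia.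
have : (#|V| - s) * (delta - s) <= c * (delta - s) by rewrite leq_mul2r Xge orbT.
lia.
Qed.

(* With [p = r * (m - 1)] and [z = p - s] the claim reads
   [4 m z < (n - p + z) (delta - p + z)], where [n - p >= 39/28 m] and
   [delta - p >= 13/14 m]. *)
Lemma counting_contradiction (n h r m delta s : nat) : 2 <= r ->
  n = h.*2 -> 8 * r <= n -> n <= 2 * r * m ->
  28 * r ^ 2 * m.-1 <= n * (14 * r + 1) -> h + m <= delta ->
  s <= r * m.-1 -> 4 * m * (r * m.-1 - s) < (n - s) * (delta - s).
Proof.
move=> r2 nh n8 nm hq hd sp.
set p := r * m.-1 in sp *; pose z := p - s.
have r0 : 0 < r by lia.
have m4 : 4 <= m by rewrite -(leq_pmul2l (m := 2 * r)); lia.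
have rp : 28 * r * p <= n * (14 * r + 1) by rewrite /p; nia.
have qp : 2 * m.-1 <= p by rewrite /p leq_mul2r r2 orbT.
(* By [rp], [p] is at most [n/2 + n/(28r)]. The last term is at most [n/56] since [r >= 2], and at
   most [m/14] since [n <= 2rm]; this gives [pn] and [ph]. *)
have pn : 56 * p <= 29 * n by rewrite -(leq_pmul2l r0); nia.
have ph : 14 * p <= 14 * h + m by rewrite -(leq_pmul2l r0); nia.
(* From [pn] and [qp], [n - p >= 27/29 p >= 54/29 (m - 1)], and [m >= 4] makes this at least
   [39/28 m]. *)
have an : 39 * m <= 28 * (n - p) by lia.
have bn : 13 * m <= 14 * (delta - p) by lia.
have -> : n - s = (n - p) + z by lia.
have -> : delta - s = (delta - p) + z by lia.
rewrite -/z; move: (n - p) (delta - p) an bn => a b an bn.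
have m0 : 0 < m by lia.
have le : (39 * m + 28 * z) * (13 * m + 14 * z) <= (28 * (a + z)) * (14 * (b + z)).
  by apply: leq_mul; lia.
have mm : 0 < m * m by rewrite muln_gt0 m0.
rewrite mulnACA in le; move: ((a + z) * (b + z)) le => Y.
(* The quadratic form [(39/28 m + z)(13/14 m + z) - 4mz] is positive definite. Written in the
   smaller of [m], [z] and their difference [w], it has only positive coefficients. *)
clearbody z; clear -mm; have [zm|/ltnW mz] := leqP z m.
  have [w mw] : exists w, m = z + w by exists (m - z); lia.
  by subst m; nia.
have [w zw] : exists w, z = m + w by exists (z - m); lia.
by rewrite zw; nia.
Qed.

(** * Colour classes as relations, and involutions as edge sets *)

Lemma adj_edges (V : finType) (G : sgraph V) (x y : V) :
  [set x; y] \in edges G -> G x y.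
Proof.
case/imsetP => -[a b]; rewrite inE /= => Gab E.
have ab : a != b by apply: contraTneq Gab => ->; rewrite adj_irr.
have /set2P[] : a \in [set x; y] by rewrite E set21.
all: have /set2P[] : b \in [set x; y] by rewrite E set22.
all: by move=> bE aE; move: ab Gab; rewrite aE bE ?eqxx // adj_sym.
Qed.

Section Colouring.
Variables (V : finType) (G : sgraph V) (I : finType) (c : edge G -> I).

Definition coloured (i : I) : rel V :=
  fun x y => [exists f : edge G, (val f == [set x; y]) && (c f == i)].

Lemma colouredP i x y :
  reflect (exists2 f : edge G, val f = [set x; y] & c f = i) (coloured i x y).
Proof.
apply: (iffP existsP) => -[f]; first by case/andP => /eqP ? /eqP; exists f.
by move=> Ef cf; exists f; rewrite Ef cf !eqxx.
Qed.

Lemma coloured_sym i : symmetric (coloured i).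
Proof. by move=> x y; rewrite /coloured setUC. Qed.

Lemma coloured_adj i x y : coloured i x y -> G x y.
Proof.
by case/colouredP => f Ef _; apply: adj_edges; rewrite -Ef; apply: valP.
Qed.

Lemma coloured_irr i : irreflexive (coloured i).
Proof. by move=> x; apply: contraFF (adj_irr G x) => /coloured_adj. Qed.

Lemma edge_of_adj x y : G x y -> exists f : edge G, val f = [set x; y].
Proof.
move=> Gxy; suff fE : [set x; y] \in edges G.
  by exists (exist (fun f => f \in edges G) _ fE).
by apply/imsetP; exists (x, y); rewrite ?inE.
Qed.

Lemma degree_coloured x : degree G x <= \sum_i #|[set y | coloured i x y]|.
Proof.
apply: leq_trans (leq_card_bigcup _ _); apply: subset_leq_card.
apply/subsetP => y; rewrite inE => /edge_of_adj[f Ef].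
by apply/bigcupP; exists (c f); rewrite // inE; apply/colouredP; exists f.
Qed.

Definition matching_edges (h : {ffun V -> V}) : {set edge G} :=
  [set f : edge G | [exists x, val f == [set x; h x]]].

Lemma perfect_matching_edges (h : {ffun V -> V}) :
  matching G h -> (forall x, h x != x) -> perfect_matching (matching_edges h).
Proof.
move=> /matchingP[hK hG] hfix v.
have [f0 Ef0] := edge_of_adj (hG v (hfix v)).
apply/eqP/cards1P; exists f0; apply/setP => f; rewrite !inE.
apply/andP/eqP => [[/existsP[x /eqP Ef]]|->].
  rewrite Ef !inE => xv; apply: val_inj; rewrite Ef Ef0.
  by case/orP: xv => /eqP ->; rewrite ?hK // setUC.
by rewrite Ef0 !inE eqxx; split=> //; apply/existsP; exists v.
Qed.

(** Every vertex matched by [g] is an end of an edge of colour [i] in [matching_edges h], and each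
    edge has at most two ends. *)
Lemma card_matched_coloured (g h : {ffun V -> V}) i :
  matching (coloured i) g -> {in matched g, h =1 g} ->
  #|matched g| <= #|[set f in matching_edges h | c f == i]|.*2.
Proof.
move=> /matchingP[gK gi] hg; rewrite -muln2 -sum_nat_const.
set A := [set _ in _ | _].
apply: (@leq_trans #|\bigcup_(f in A) val f|).
  apply: subset_leq_card; apply/subsetP => x xg.
  have := gi x; rewrite -matchedF => /(_ xg)/colouredP[f Ef cf].
  apply/bigcupP; exists f; last by rewrite Ef !inE eqxx.
  by rewrite !inE cf eqxx andbT; apply/existsP; exists x; rewrite Ef hg.
apply: leq_trans (leq_card_bigcup _ _) _; apply: leq_sum => f.
by rewrite !inE => /andP[/existsP[x /eqP ->] _]; rewrite cards2; case: eqP.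
Qed.

End Colouring.

(** * Rounding the real bounds and assembling the proof *)

Import Order.TTheory GRing.Theory Num.Theory.
Local Open Scope ring_scope.

Theorem corollary1p12 (R : realType) (r : nat) (hr : (2 <= r)%N) :
  exists n0 : nat,
  forall (n : nat) (d : R) (V : finType) (G : sgraph V),
    (n0 <= n)%N -> ~~ odd n ->
    0 <= d <= n%:R / (28%:R * r%:R ^+ 2) ->
    #|V| = n ->
    (r%:R + 1) * n%:R / (2%:R * r%:R) + d <= (min_degree G)%:R ->
    forall c : edge G -> 'I_r,
    exists (M : {set edge G}) (i : 'I_r),
      perfect_matching M /\
      n%:R / (2%:R * r%:R) + d <= #|[set f in M | c f == i]|%:R.
Proof.
(* Together with [n <= 2rm], the bound [n >= 8r] forces [m >= 4] in [counting_contradiction]. *)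
exists (8 * r)%N => n d V G n8 nev /andP[d0 dle] cV hdeg c.
have rgt0 : 0 < r%:R :> R by rewrite ltr0n; lia.
have n0 : (0 < n)%N by lia.
have ngt0 : 0 < n%:R :> R by rewrite ltr0n.
set rho := n%:R / (2%:R * r%:R) + d.
have nh : n = n./2.*2 by rewrite even_halfK.
have nhR : n%:R = 2%:R * n./2%:R :> R by rewrite -natrM mul2n -nh.
(* The degree hypothesis reads [n/2 + rho], because [(r+1)n/(2r) = n/2 + n/(2r)]. *)
have rho_deg : rho <= (min_degree G - n./2)%:R.
  have := hdeg; rewrite (_ : (_ + 1) * _ / _ + d = n./2%:R + rho); last first.
    by rewrite /rho nhR; field; rewrite gt_eqF.
  move=> le; rewrite natrB; first by rewrite lerBrDl.
  rewrite -(ler_nat R); apply: le_trans le; rewrite lerDl /rho addr_ge0 //.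
  by rewrite divr_ge0 // ?ltW // mulr_gt0.
have exm : exists k : nat, rho <= k%:R by exists (min_degree G - n./2)%N.
have rho0 : 0 < rho.
  by rewrite /rho ltr_pwDl // divr_gt0 // mulr_gt0.
(* [m] is the ceiling of [rho]: its minimality yields both [n/2 + m <= min_degree G], an inequality
   between integers, and [m - 1 < rho]. *)
case: (ex_minnP exm) => m rho_m m_min.
have m0 : (0 < m)%N by rewrite -(ltr_nat R); apply: lt_le_trans rho_m.
have hm : (n./2 + m <= min_degree G)%N by have := m_min _ rho_deg; lia.
have m1 : m.-1%:R < rho.
  by rewrite ltNge; apply/negP => /m_min; lia.
have nrm : (n <= 2 * r * m)%N.
  rewrite -(ler_nat R) !natrM.
  have : n%:R / (2%:R * r%:R) <= m%:R :> R.
    by apply: le_trans rho_m; rewrite lerDl.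
  by rewrite ler_pdivrMr ?mulr_gt0 // mulrC.
have hq : (28 * r ^ 2 * m.-1 <= n * (14 * r + 1))%N.
  rewrite -(ler_nat R) !natrM natrD natrM -expr2.
  have : m.-1%:R <= n%:R / (2%:R * r%:R) + n%:R / (28%:R * r%:R ^+ 2) :> R.
    by apply: le_trans (ltW m1) _; rewrite lerD2l.
  rewrite (_ : _ + _ = n%:R * (14%:R * r%:R + 1) / (28%:R * r%:R ^+ 2)).
    by rewrite ler_pdivlMr ?mulr_gt0 ?exprn_gt0 // mulrC.
  by field; rewrite gt_eqF.
have degG x : (min_degree G <= degree G x)%N.
  by have := leq_min_degree G (min_degree G); rewrite cV leqnn => /(_ n0)/esym/forallP.
have [||x||s hs|i [f [mf fm]]] :=
  @monochromatic_matching V r (coloured c) (min_degree G) m.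
- exact: coloured_sym.
- exact: coloured_irr.
- exact: leq_trans (degG x) (degree_coloured c x).
- exact: m0.
- by rewrite cV; apply: (@counting_contradiction n n./2).
(* Extension asks for twice the degree to be at least [n + #|matched g|]; with exactly [m] edges
   this is [n + 2m], as [hm] provides. *)
have [g mg gm] := matching_exact_card mf fm.
have [gK gi] := matchingP _ _ mg.
have mgG : matching G g.
  by apply/matchingP; split=> // x /gi /coloured_adj.
have [||||h mh [hfix hg]] := @matching_extends_to_perfect V G g _ _ _ mgG.
- exact: adj_sym.
- exact: adj_irr.
- by rewrite cV.
- by move=> x; have := degG x; rewrite cV gm /degree; lia.
exists (matching_edges G h), i; split; first exact: perfect_matching_edges.
apply: le_trans rho_m _; rewrite ler_nat -leq_double -gm.
exact: card_matched_coloured.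
Qed.
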